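(* A strongly self-dual pseudocompact Boolean group need not be selectively pseudocompact; that is, there exists a strongly self-dual pseudocompact Boolean topological group which is not selectively pseudocompact.
   Context: All topological groups are assumed to be Hausdorff. A group $G$ is Boolean if $x^2=e$ for every $x\in G$, where $e$ is the identity element (every Boolean group is abelian). A space is pseudocompact if every continuous real-valued function on it is bounded. For an abelian topological group $G$, its Pontryagin dual $G^\wedge$ is the group of all continuous group homomorphisms from $G$ to the circle group $\mathbb{T}$, endowed with the compact-open topology. $G$ is strongly self-dual if there exists a topological isomorphism $\Phi:G\to G^\wedge$ of $G$ onto $G^\wedge$ such that $\Phi(x)(y)=\Phi(y)(x)$ for all $x,y\in G$. A point $x$ of a topological space $X$ is an accumulation point of a sequence $\{x_n:n\in\mathbb{N}\}$ of points of $X$ if the set $\{n\in\mathbb{N}: x_n\in V\}$ is infinite for every neighbourhood $V$ of $x$ in $X$. A topological space $X$ is selectively pseudocompact if for every sequence $\{U_n:n\in\mathbb{N}\}$ of non-empty open subsets of $X$ one can choose $x_n\in U_n$ for every $n\in\mathbb{N}$ such that the sequence $\{x_n:n\in\mathbb{N}\}$ has an accumulation point in $X$. *)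

(* Defs.v *)
From HB Require Import structures.
From mathcomp Require Import all_boot all_order all_algebra.
From mathcomp Require Import all_classical all_reals all_analysis.
From mathcomp Require Import complex.

Set Implicit Arguments.
Unset Strict Implicit.
Unset Printing Implicit Defensive.

Import Order.TTheory GRing.Theory Num.Theory.
Import numFieldNormedType.Exports.

Local Open Scope classical_set_scope.
Local Open Scope ring_scope.

Section circle_group.
Variable R : realType.

Definition circle : Type := set_type [set z : R[i] | `|z| = 1].

HB.instance Definition _ := SubChoice.on circle.

(* (R[i])^o carries the topology of the modulus, R[i] itself carries none. *)
HB.instance Definition _ :=
  Topological.copy circle (set_type [set z : (R[i])^o | `|z| = 1]).

Implicit Types z w : circle.

Lemma circle_norm z : `|val z| = 1.
Proof. exact: (set_valP z). Qed.

Definition to_circle (z : R[i]) (z1 : `|z| = 1) : circle := SigSub (mem_set z1).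

Lemma circle_norm1 : `|1 : R[i]| = 1. Proof. exact: normr1. Qed.

Lemma circle_normM z w : `|val z * val w| = 1.
Proof. by rewrite normrM !circle_norm mulr1. Qed.

Lemma circle_normV z : `|(val z)^-1| = 1.
Proof. by rewrite normfV circle_norm invr1. Qed.

(* The group law is multiplication of complex numbers; it is written
   additively so that the library's structures of abelian groups apply. *)
Definition circle_zero : circle := to_circle circle_norm1.
Definition circle_opp z : circle := to_circle (circle_normV z).
Definition circle_add z w : circle := to_circle (circle_normM z w).

Lemma circle_addA : associative circle_add.
Proof. by move=> x y z; apply: val_inj; rewrite /= mulrA. Qed.

Lemma circle_addC : commutative circle_add.
Proof. by move=> x y; apply: val_inj; rewrite /= mulrC. Qed.

Lemma circle_add0 : left_id circle_zero circle_add.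
Proof. by move=> x; apply: val_inj; rewrite /= mul1r. Qed.

Lemma circle_addN : left_inverse circle_zero circle_opp circle_add.
Proof.
move=> x; apply: val_inj; rewrite /= mulVf //.
by rewrite -normr_eq0 circle_norm oner_eq0.
Qed.

HB.instance Definition _ := GRing.isZmodule.Build circle
  circle_addA circle_addC circle_add0 circle_addN.

Lemma circle_valD z w : val (z + w) = val z * val w.
Proof. by []. Qed.

Lemma circle_val0 : val (0 : circle) = 1.
Proof. by []. Qed.

Lemma circle_valN z : val (- z) = (val z)^-1.
Proof. by []. Qed.

Lemma circle_val_continuous :
  continuous (fun z : circle => val z : (R[i])^o).
Proof. exact: initial_continuous. Qed.

Lemma circle_sub_continuous :
  continuous (fun x : circle * circle => x.1 - x.2).
Proof.
apply: (@continuous_comp_initial _ _ _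
  (set_val : set_type [set z : (R[i])^o | `|z| = 1] -> (R[i])^o)) => -[z w].
apply: (@cvgM (R[i])%type).
  by apply: (@continuous_comp _ _ _ fst);
    [exact: cvg_fst | exact: circle_val_continuous].
apply: (@cvgV (R[i])%type).
  by rewrite -normr_eq0 circle_norm oner_eq0.
by apply: (@continuous_comp _ _ _ snd);
  [exact: cvg_snd | exact: circle_val_continuous].
Qed.

HB.instance Definition _ :=
  PreTopologicalNmodule_isTopologicalZmodule.Build circle circle_sub_continuous.

End circle_group.

Section dual_group.
Variables (R : realType) (G : topologicalZmodType).

Definition characters : set {compact-open, G -> circle R} :=
  [set f | continuous (f : G -> circle R) /\ {morph f : x y / x + y}].

(* Subsets of a topological space, seen as types, have the subspace topology. *)
Definition dual : Type := set_type characters.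

HB.instance Definition _ := SubChoice.on dual.
HB.instance Definition _ := Topological.copy dual (set_type characters).

Definition dual_fun (f : dual) : G -> circle R := val f.

Implicit Types f g : dual.

Lemma dual_continuous f : continuous (dual_fun f).
Proof. by have [] := set_valP f. Qed.

Lemma dualD f : {morph dual_fun f : x y / x + y}.
Proof. by have [] := set_valP f. Qed.

Definition to_dual (h : G -> circle R) (h_char : characters h) : dual :=
  SigSub (mem_set h_char).

Lemma characters0 : characters (fun=> 0).
Proof. by split=> [x|x y]; [exact: cvg_cst | rewrite addr0]. Qed.

Lemma charactersN f : characters (fun x => - dual_fun f x).
Proof.
split=> [x|x y]; last by rewrite dualD opprD.
by apply: continuous_comp; [exact: dual_continuous | exact: opp_continuous].
Qed.

Lemma charactersD f g : characters (fun x => dual_fun f x + dual_fun g x).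
Proof.
split=> [x|x y]; last by rewrite !dualD addrACA.
apply: (@continuous_comp _ _ _ (fun y => (dual_fun f y, dual_fun g y))
                               (fun z => z.1 + z.2)).
  exact: (cvg_pair (@dual_continuous f x) (@dual_continuous g x)).
exact: add_continuous.
Qed.

Definition dual_zero : dual := to_dual characters0.
Definition dual_opp f : dual := to_dual (charactersN f).
Definition dual_add f g : dual := to_dual (charactersD f g).

Lemma dual_addA : associative dual_add.
Proof. by move=> f g h; apply: val_inj; apply/funext => x; exact: addrA. Qed.

Lemma dual_addC : commutative dual_add.
Proof. by move=> f g; apply: val_inj; apply/funext => x; exact: addrC. Qed.

Lemma dual_add0 : left_id dual_zero dual_add.
Proof. by move=> f; apply: val_inj; apply/funext => x; exact: add0r. Qed.

Lemma dual_addN : left_inverse dual_zero dual_opp dual_add.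
Proof. by move=> f; apply: val_inj; apply/funext => x; exact: addNr. Qed.

HB.instance Definition _ := GRing.isZmodule.Build dual
  dual_addA dual_addC dual_add0 dual_addN.

End dual_group.

Coercion dual_fun : dual >-> Funclass.

Definition topological_isomorphism (G H : PreTopologicalZmodule.type)
    (f : G -> H) : Prop :=
  [/\ {morph f : x y / x + y}, continuous f &
      exists g : H -> G, [/\ cancel f g, cancel g f & continuous g]].

Definition strongly_self_dual (R : realType) (G : topologicalZmodType) : Prop :=
  exists2 Phi : G -> dual R G,
    topological_isomorphism Phi & forall x y : G, Phi x y = Phi y x.

(* x^2 = e in additive notation *)
Definition boolean_group (G : zmodType) : Prop := forall x : G, x + x = 0.

Definition pseudocompact (R : realType) (X : topologicalType) : Prop :=
  forall f : X -> R, continuous f -> bounded_fun f.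

Definition accumulation_point (X : topologicalType) (x_ : nat -> X) (x : X) :
    Prop :=
  forall V : set X, nbhs x V -> infinite_set [set n | V (x_ n)].

Definition selectively_pseudocompact (X : topologicalType) : Prop :=
  forall U : nat -> set X, (forall n, open (U n) /\ U n !=set0) ->
  exists2 x_ : nat -> X, (forall n, U n (x_ n)) &
    exists x : X, accumulation_point x_ x.

(* Main.v *)
(* Vertices are well-founded trees with countable branching and signed edges to
   the children; two vertices are adjacent when one is a positive child of the
   other. Since no vertex is a child of its own child, any 0-1 valued function
   on countably many vertices is the adjacency to some vertex. The adjacency
   extends to a symmetric bilinear form on the free Boolean group on the
   vertices, and the group carries the coarsest topology making the form
   separately continuous. Then, on any countable set of vectors, every linear
   form is the pairing with some vector.
   - Given open sets [U_ n], an ultrafilter limit of points of the [U_ n] can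
     therefore be realized on the countably many coordinates involved in the
     [U_ n], which gives pseudocompactness.
   - A sequence [x_ n] such that [x_ n] pairs to 0 with [t_ i] for [i < n] and
     to 1 with [t_ n] has no accumulation point: a limit of solutions of
     triangular systems is a form equal to 1 on all [x_ n], which vanishes on
     every candidate. Infinite compact sets would contain such sequences up to
     translation; hence compact sets are finite, the dual has the topology of
     pointwise convergence and the form is a strong self-duality. As the
     conditions on [x_ n] define an open set, which is nonempty for distinct
     vertices [t_ i], the group is not selectively pseudocompact. *)
Require Import Defs.
From HB Require Import structures.
From mathcomp Require Import all_boot all_order all_algebra.
From mathcomp Require Import all_classical all_reals all_analysis.
From mathcomp Require Import complex.

Set Implicit Arguments.
Unset Strict Implicit.
Unset Printing Implicit Defensive.

Import Order.TTheory GRing.Theory Num.Theory.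
Import numFieldNormedType.Exports.

Local Open Scope classical_set_scope.
Local Open Scope ring_scope.

(** * The graph of signed trees *)

Inductive vertex : Type :=
  | Leaf of nat
  | Node of (nat -> vertex) & (nat -> bool).

HB.instance Definition _ := gen_eqMixin vertex.

Definition child (i j : vertex) : Prop :=
  if i is Node f _ then exists n, f n = j else False.

Definition positive_child (i j : vertex) : Prop :=
  if i is Node f s then exists2 n, f n = j & s n else False.

Definition adj (i j : vertex) : bool :=
  `[< positive_child i j \/ positive_child j i >].

Lemma adj_sym i j : adj i j = adj j i.
Proof. by apply: asbool_equiv_eq; split=> -[]; [right|left|right|left]. Qed.

(** Induction on the tree [i]: a mutual pair starting at [i] is also one starting at its child [j],
    an immediate subtree. *)
Lemma child_asym i j : child i j -> ~ child j i.
Proof.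
elim: i j => [//|f IH s] _ [n <-] fni.
by apply: (IH n _ fni); exists n.
Qed.

Lemma positive_childW i j : positive_child i j -> child i j.
Proof. by case: i => //= f s [n fnj _]; exists n. Qed.

(** Signs read off [h] are consistent on repetitions in [f], and by [child_asym] no edge comes from
    the node being a child of [f n]. *)
Lemma adj_node (f : nat -> vertex) (h : vertex -> bool) n :
  adj (Node f (h \o f)) (f n) = h (f n).
Proof.
apply/asboolP/idP => [[[m /= fmn]|]|hn]; first by rewrite fmn.
  by move=> /positive_childW /child_asym []; exists n.
by left; exists n.
Qed.

Lemma enumerate_bigcup (s : nat -> seq vertex) :
  exists f : nat -> vertex, forall n t, t \in s n -> exists k, f k = t.
Proof.
pose g (p : nat * nat) := nth (Leaf 0) (s p.1) p.2.
exists (fun k => g (odflt (0, 0)%N (unpickle k))) => n t tsn.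
by exists (pickle (n, index t (s n))); rewrite pickleK /g /= nth_index.
Qed.

Lemma adj_realizes (s : nat -> seq vertex) (h : vertex -> bool) :
  exists i, forall n t, t \in s n -> adj i t = h t.
Proof.
have [f fP] := enumerate_bigcup s.
by exists (Node f (h \o f)) => n t /fP[k <-]; exact: adj_node.
Qed.

(** * The free Boolean group and its linear forms *)

(* The free Boolean group on the vertices: the vector [\sum_(t <- s) t] is
   represented by the evaluation of the linear forms on it, a linear form being
   given by its arbitrary values on the vertices. *)
Definition finite_sum_of_evaluations : set ((vertex -> bool) -> bool) :=
  [set x | exists s : seq vertex, x = fun h => \sum_(t <- s) h t].

Definition bgroup : Type := set_type finite_sum_of_evaluations.

HB.instance Definition _ := SubChoice.on bgroup.

Definition ev (x : bgroup) : (vertex -> bool) -> bool := val x.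

Lemma ev_inj (x y : bgroup) : ev x =1 ev y -> x = y.
Proof. by move=> xy; apply/val_inj/funext. Qed.

Lemma ev_support (x : bgroup) :
  exists s : seq vertex, forall h, ev x h = \sum_(t <- s) h t.
Proof. by have [s xE] := set_valP x; exists s => h; rewrite /ev xE. Qed.

Definition to_bgroup (s : seq vertex) : bgroup :=
  SigSub (mem_set (ex_intro _ s erefl : finite_sum_of_evaluations _)).

Lemma finite_sum0 : finite_sum_of_evaluations (fun=> 0).
Proof. by exists [::]; apply/funext => h; rewrite big_nil. Qed.

Lemma finite_sumD (x y : bgroup) :
  finite_sum_of_evaluations (fun h => ev x h + ev y h).
Proof.
have [[s xE] [s' yE]] := (ev_support x, ev_support y).
by exists (s ++ s'); apply/funext => h; rewrite big_cat xE yE.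
Qed.

Definition bgroup0 : bgroup := SigSub (mem_set finite_sum0).
Definition bgroupD (x y : bgroup) : bgroup :=
  SigSub (mem_set (finite_sumD x y)).

Lemma bgroupDA : associative bgroupD.
Proof. by move=> x y z; apply: ev_inj => h; exact: addrA. Qed.

Lemma bgroupDC : commutative bgroupD.
Proof. by move=> x y; apply: ev_inj => h; exact: addrC. Qed.

Lemma bgroup0D : left_id bgroup0 bgroupD.
Proof. by move=> x; apply: ev_inj => h; exact: add0r. Qed.

Lemma bgroupDD : left_inverse bgroup0 id bgroupD.
Proof. by move=> x; apply: ev_inj => h; exact: addbb. Qed.

HB.instance Definition _ := GRing.isZmodule.Build bgroup
  bgroupDA bgroupDC bgroup0D bgroupDD.

Lemma bgroup_oppE (x : bgroup) : - x = x. Proof. by []. Qed.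

Lemma ev_linD x h h' : ev x (fun t => h t + h' t) = ev x h + ev x h'.
Proof. by have [s xE] := ev_support x; rewrite !xE big_split. Qed.

Lemma ev_lin0 x : ev x (fun=> 0) = 0.
Proof. by have [s xE] := ev_support x; rewrite xE big1. Qed.

Definition basis_vector (t : vertex) : bgroup := to_bgroup [:: t].

Lemma ev_basis t h : ev (basis_vector t) h = h t.
Proof. exact: big_seq1. Qed.

(** * Coordinates and the bilinear form *)

Definition coordinate (x : bgroup) (t : vertex) : bool := ev x (adj t).

Lemma coordinate_basis i t : coordinate (basis_vector i) t = adj i t.
Proof. by rewrite /coordinate ev_basis adj_sym. Qed.

Lemma coordinateD (x y : bgroup) t :
  coordinate (x + y) t = coordinate x t + coordinate y t.
Proof. by []. Qed.

Lemma interpolation (s : nat -> seq vertex) (h : vertex -> bool) :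
  exists x, forall n t, t \in s n -> coordinate x t = h t.
Proof.
have [i iP] := adj_realizes s h.
by exists (basis_vector i) => n t tsn; rewrite coordinate_basis (iP n).
Qed.

(** Supports are finite, so only the values of [h] on countably many vertices matter. *)
Lemma ev_realizes (x_ : nat -> bgroup) (h : vertex -> bool) :
  exists i, forall n, ev (x_ n) h = coordinate (x_ n) i.
Proof.
have [s sP] := choice (fun n => ev_support (x_ n)).
have [i iP] := adj_realizes s h; exists i => n.
by rewrite /coordinate !sP; apply: eq_big_seq => t /iP ->.
Qed.

(** A linear form telling [x] from [y] is realized by a coordinate on the sequence [x], [y], [y],
    ... *)
Lemma coordinate_separates x y :
  x <> y -> exists t, coordinate x t <> coordinate y t.
Proof.
move=> xy; apply: contrapT => /forallNP noti; apply: xy; apply: ev_inj => h.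
have [i iP] := ev_realizes (fun n => if n is 0%N then x else y) h.
by rewrite (iP 0%N) (iP 1%N); apply: contrapT; exact: noti.
Qed.

Definition pairing (x y : bgroup) : bool := ev y (coordinate x).

Lemma pairing_sym x y : pairing x y = pairing y x.
Proof.
have [[s xE] [s' yE]] := (ev_support x, ev_support y).
rewrite /pairing /coordinate xE yE.
under eq_bigr do rewrite xE.
under [RHS]eq_bigr do rewrite yE.
rewrite exchange_big /=; apply: eq_bigr => i _; apply: eq_bigr => j _.
exact: adj_sym.
Qed.

Lemma pairingDr (x y z : bgroup) :
  pairing x (y + z) = pairing x y + pairing x z.
Proof. by []. Qed.

Lemma pairingDl (x y z : bgroup) :
  pairing (x + y) z = pairing x z + pairing y z.
Proof. by rewrite pairing_sym pairingDr !(pairing_sym z). Qed.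

Lemma pairing_basis x t : pairing x (basis_vector t) = coordinate x t.
Proof. exact: ev_basis. Qed.

(** * The group topology *)

Definition cylinder (x : bgroup) (s : seq vertex) : set bgroup :=
  [set y | forall t, t \in s -> coordinate y t = coordinate x t].

Lemma cylinderxx x s : cylinder x s x. Proof. by []. Qed.

Lemma cylinder_cat x s s' :
  cylinder x (s ++ s') `<=` cylinder x s `&` cylinder x s'.
Proof. by move=> y xy; split=> t ts; apply: xy; rewrite mem_cat ts ?orbT. Qed.

Lemma cylinder_trans x y s : cylinder x s y -> cylinder y s `<=` cylinder x s.
Proof. by move=> xy z yz t ts; rewrite yz // xy. Qed.

HB.instance Definition _ := hasNbhs.Build bgroup
  (fun x => filter_from setT (cylinder x)).

Lemma nbhs_cylinder x s : nbhs x (cylinder x s).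
Proof. by exists s. Qed.

Lemma nbhs_cylinderP (x : bgroup) U :
  nbhs x U <-> exists s, cylinder x s `<=` U.
Proof. by split=> [[s _ sU]|[s sU]]; exists s. Qed.

Lemma bgroup_nbhs_filter (x : bgroup) : ProperFilter (nbhs x).
Proof.
apply: filter_from_proper => [|s _]; last by exists x; exact: cylinderxx.
apply: filter_from_filter => [|s s' _ _]; first by exists [::].
by exists (s ++ s') => //; exact: cylinder_cat.
Qed.

Lemma bgroup_nbhs_singleton (x : bgroup) (U : set bgroup) : nbhs x U -> U x.
Proof. by move=> /nbhs_cylinderP[s]; apply; exact: cylinderxx. Qed.

Lemma bgroup_nbhs_nbhs (x : bgroup) (U : set bgroup) :
  nbhs x U -> nbhs x (nbhs^~ U).
Proof.
move=> /nbhs_cylinderP[s sU]; apply/nbhs_cylinderP; exists s => y xy.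
apply/nbhs_cylinderP; exists s.
exact: subset_trans (cylinder_trans xy) sU.
Qed.

HB.instance Definition _ := Nbhs_isNbhsTopological.Build bgroup
  bgroup_nbhs_filter bgroup_nbhs_singleton bgroup_nbhs_nbhs.

Lemma bgroup_sub_continuous : continuous (fun x : bgroup * bgroup => x.1 - x.2).
Proof.
move=> [x y] U /nbhs_cylinderP[s sU].
exists (cylinder x s, cylinder y s); first by split; exact: nbhs_cylinder.
move=> [x' y'] /= [xx yy]; apply: sU => t ts.
by rewrite !bgroup_oppE !coordinateD xx // yy.
Qed.

HB.instance Definition _ :=
  PreTopologicalNmodule_isTopologicalZmodule.Build bgroup bgroup_sub_continuous.

Lemma bgroup_hausdorff : hausdorff_space bgroup.
Proof.
move=> x y xy; apply: contrapT => /coordinate_separates[t]; apply.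
have [z [xz yz]] := xy _ _ (nbhs_cylinder x [:: t]) (nbhs_cylinder y [:: t]).
by rewrite -xz ?mem_head // yz ?mem_head.
Qed.

Lemma bgroup_boolean : boolean_group bgroup.
Proof. exact: bgroupDD. Qed.

(** * Ultrafilter limits and triangular systems *)

Lemma ultrafilter_on_nat :
  exists F : set_system nat, UltraFilter F /\ \oo `<=` F.
Proof. exact: ultraFilterLemma. Qed.

(** The right-hand side is the pointwise limit of [h_] along [F]; finitely many of its values are
    attained simultaneously. *)
Lemma ultra_seq_limit (F : set_system nat) (h_ : nat -> vertex -> bool)
    (FU : UltraFilter F) (s : seq vertex) :
  F [set n | forall t, t \in s -> h_ n t = `[< F [set m | h_ m t] >] ].
Proof.
elim: s => [|t s IH]; first by apply: filterS filterT.
have Ft : F [set n | h_ n t = `[< F [set m | h_ m t] >]].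
  case: asboolP => [|nF]; first by apply: filterS.
  have [//|] := in_ultra_setVsetC [set m | h_ m t] FU.
  by apply: filterS => n /= /negP/negbTE.
apply: filterS (filterI Ft IH) => n /= [tn sn] t'.
by rewrite inE => /orP[/eqP->//|]; exact: sn.
Qed.

(** Back substitution: [g] settles equation [m], and the induction hypothesis corrects its effect on
    the earlier ones. The second conclusion, that [h] depends only on the coordinates [t_ i] with
    [i < m], keeps this correction from disturbing equation [m]. *)
Lemma triangular_system (x_ : nat -> bgroup) (t_ : nat -> vertex) :
  (forall n i, (i < n)%N -> coordinate (x_ n) (t_ i) = 0) ->
  (forall n, coordinate (x_ n) (t_ n)) ->
  forall m (c : nat -> bool), exists h : vertex -> bool,
    (forall n, (n < m)%N -> ev (x_ n) h = c n) /\
    (forall z, (forall i, (i < m)%N -> coordinate z (t_ i) = 0) -> ev z h = 0).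
Proof.
move=> x0 x1; elim=> [|m IH] c.
  by exists (fun=> 0); split=> // z _; exact: ev_lin0.
pose g (t : vertex) := if c m then adj (t_ m) t else 0.
have evg z : ev z g = if c m then coordinate z (t_ m) else 0.
  by rewrite /g /coordinate; case: (c m) => //; exact: ev_lin0.
have [h [hP h0]] := IH (fun n => c n + ev (x_ n) g).
exists (fun t => h t + g t); split=> [n|z z0]; rewrite ev_linD.
  rewrite ltnS leq_eqVlt => /orP[/eqP->|nm]; last first.
    by rewrite hP // -addrA (addbb (ev _ g) : ev _ g + ev _ g = 0) addr0.
  by rewrite h0 ?add0r ?evg; [case: (c m) => //; exact: x1 | exact: x0].
by rewrite h0 => [|i im]; rewrite ?evg ?z0 ?if_same // ltnW.
Qed.

Lemma triangular_no_accumulation (x_ : nat -> bgroup) (t_ : nat -> vertex) :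
  (forall n i, (i < n)%N -> coordinate (x_ n) (t_ i) = 0) ->
  (forall n, coordinate (x_ n) (t_ n)) ->
  forall x, ~ accumulation_point x_ x.
Proof.
move=> x0 x1 x xacc.
have accP t N : exists2 n, (N < n)%N & coordinate (x_ n) t = coordinate x t.
  have /xacc inf := nbhs_cylinder x [:: t].
  apply: contrapT => /forall2NP noN; apply: inf.
  apply: (sub_finite_set _ (finite_II N.+1)) => n /= xn.
  by have [/negP|[]] := noN n; rewrite -?leqNgt // xn ?mem_head.
have xt0 i : coordinate x (t_ i) = 0 by have [n /x0 <-] := accP (t_ i) i.
have [h_ h_P] := choice (fun m => triangular_system x0 x1 m (fun=> true)).
have [F [FU Foo]] := ultrafilter_on_nat.
pose h t := `[< F [set m | h_ m t] >].
have evh z : F [set m | ev z (h_ m) = ev z h].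
  have [s sP] := ev_support z.
  apply: filterS (ultra_seq_limit h_ FU s) => m /= hE.
  by rewrite !sP; exact: eq_big_seq.
have xh n : ev (x_ n) h = true.
  have /Foo Fn : \oo [set m | (n < m)%N] by exists n.+1.
  have [m [/= <- nm]] := filter_ex (filterI (evh (x_ n)) Fn).
  by have [->] := h_P m.
have {}xt0 : ev x h = 0.
  have [m /= <-] := filter_ex (evh x).
  by have [_ ->] := h_P m.
(* One vertex realizes [h] on [x] and all [x_ n] at once; its coordinate is 0 at [x] and 1 along the
   sequence. *)
have [i iP] := ev_realizes (fun n => if n is n'.+1 then x_ n' else x) h.
have [n _] := accP i 0%N.
by rewrite -(iP 0%N) -(iP n.+1) xh xt0.
Qed.

(** * Failure of selective pseudocompactness *)

Lemma bgroup_not_selectively_pseudocompact : ~ selectively_pseudocompact bgroup.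
Proof.
pose U n := [set x | (forall i, (i < n)%N -> coordinate x (Leaf i) = 0) /\
                     coordinate x (Leaf n)].
move=> /(_ U)[n|x_ xU [x]].
  split.
    rewrite openE => x [x0 x1]; apply/nbhs_cylinderP.
    exists [seq Leaf i | i <- iota 0 n.+1] => y xy.
    have yx i : (i < n.+1)%N -> coordinate y (Leaf i) = coordinate x (Leaf i).
      by move=> lt_in; rewrite xy // map_f // mem_iota.
    by split=> [i lt_in|]; rewrite yx // ?x0 // ltnW.
  have [x xP] := interpolation (fun k => [:: Leaf k]) (fun t => t == Leaf n).
  exists x; split=> [i lt_in|]; rewrite (xP _ _ (mem_head _ _)) //.
  by apply/negbTE/eqP => -[/eqP]; rewrite ltn_eqF.
apply: (@triangular_no_accumulation x_ Leaf) => [n i lt_in|n].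
  by have [+ _] := xU n; apply.
by have [] := xU n.
Qed.

(** * Finiteness of compact sets *)

Lemma accumulationB (x_ : nat -> bgroup) (x y : bgroup) :
  accumulation_point x_ x -> accumulation_point (fun n => x_ n - y) (x - y).
Proof.
move=> xacc V /nbhs_cylinderP[s sV] fin; apply: (xacc _ (nbhs_cylinder x s)).
apply: sub_finite_set fin => n /= xn; apply: sV => t ts.
by rewrite !bgroup_oppE !coordinateD xn.
Qed.

(** The sets containing all but finitely many points of [K] form a proper filter; any cluster point
    of it will do. *)
Lemma infinite_compact_limit (X : topologicalType) (K : set X) :
  compact K -> infinite_set K ->
  exists x, forall U, nbhs x U -> exists z, [/\ K z, U z & z <> x].
Proof.
move=> cK iK.
pose F := [set A : set X | finite_set (K `\` A)].
have FF : ProperFilter F.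
  apply: Build_ProperFilter_ex => [A finA|].
    apply: contrapT => /forallNP A0; apply: iK.
    by apply: sub_finite_set finA => z Kz; split=> //; exact: A0.
  split=> [|A B FA FB|A B AB].
  - by rewrite /F /= setDT.
  - by rewrite /F /= setDIr finite_setU.
  - by apply: sub_finite_set => z [Kz nBz]; split=> // /AB.
have FK : F K by rewrite /F /= setDv.
have [x [_ xF]] := cK F FF FK.
exists x => U xU.
have FD : F (K `\ x).
  by rewrite /F /= setDD; apply: sub_finite_set (finite_set1 x) => z [].
by have [z [[Kz zx] Uz]] := xF _ _ FD xU; exists z.
Qed.

Lemma compact_accumulation (X : topologicalType) (K : set X) (x_ : nat -> X) :
  compact K -> (forall n, K (x_ n)) -> exists x, accumulation_point x_ x.
Proof.
move=> cK Kx.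
have [x [_ xP]] : K `&` cluster (x_ @ \oo) !=set0.
  by apply: cK; exists 0%N => // n _; exact: Kx.
exists x => V xV /finite_seqP[s sE].
have tail : \oo [set n | n \notin s].
  exists (\max_(i <- s) i).+1 => // n /= sn; apply/negP => ns.
  by have := leq_bigmax_seq (F := id) _ ns isT; rewrite leqNgt sn.
have [_ [[n ns <-] Vn]] : x_ @` [set n | n \notin s] `&` V !=set0.
  by apply: xP xV; apply: filterS tail => n ns; exists n.
have : [set n | V (x_ n)] n by [].
by rewrite sE => /= ns'; rewrite /= ns' in ns.
Qed.

Lemma bgroup_compact_finite (K : set bgroup) : compact K -> finite_set K.
Proof.
move=> cK; apply: contrapT => iK.
have [x xP] := infinite_compact_limit cK iK.
have /choice[F FP] (s : seq vertex) : exists p : bgroup * vertex,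
    [/\ K p.1, cylinder x s p.1 & coordinate p.1 p.2 <> coordinate x p.2].
  have [z [Kz xz /coordinate_separates[t zt]]] := xP _ (nbhs_cylinder x s).
  by exists (z, t).
(* [s_ n] lists the vertices chosen before stage [n]. The next point of [K] agrees with [x] on them
   and differs from [x] at a new vertex, so the differences with [x] are triangular. *)
pose s_ n := iter n (fun s => (F s).2 :: s) [::].
have s_mem n i : (i < n)%N -> (F (s_ i)).2 \in s_ n.
  elim: n => // n IH; rewrite ltnS leq_eqVlt => /orP[/eqP->|/IH im].
    exact: mem_head.
  by rewrite inE im orbT.
have [y yacc] : exists y, accumulation_point (fun n => (F (s_ n)).1) y.
  by apply: compact_accumulation cK _ => n; have [] := FP (s_ n).
apply: (@triangular_no_accumulation (fun n => (F (s_ n)).1 - x)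
  (fun n => (F (s_ n)).2) _ _ (y - x)); last exact: accumulationB.
- move=> n i lt_in; have [_ + _] := FP (s_ n).
  move=> /(_ _ (s_mem _ _ lt_in)); rewrite bgroup_oppE coordinateD => ->.
  exact: addbb.
- move=> n; have [_ _] := FP (s_ n).
  by rewrite bgroup_oppE coordinateD; case: (coordinate _ _);
    case: (coordinate _ _).
Qed.

(** * Pseudocompactness *)

Lemma bgroup_pseudocompact (R : realType) : pseudocompact R bgroup.
Proof.
move=> f fcont; apply: contrapT => unbounded.
have /choice[v_ v_P] n : exists v, n%:R < `|f v|.
  apply: contrapT => /forallNP fn; apply: unbounded.
  exists n%:R; split; first exact: num_real.
  by move=> M nM v _ /=; rewrite (le_trans _ (ltW nM)) // leNgt; apply/negP/fn.
have norm_cont : continuous (fun v => `|f v|).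
  by move=> v; apply: continuous_comp; [exact: fcont|exact: norm_continuous].
have /choice[s_ s_P] n :
    exists s, cylinder (v_ n) s `<=` [set w | n%:R < `|f w|].
  apply/nbhs_cylinderP; apply: (norm_cont (v_ n) [set r | n%:R < r]).
  exact: lt_nbhsr (v_P n).
have [F [FU Foo]] := ultrafilter_on_nat.
pose h_ n t := coordinate (v_ n) t.
have [v vP] := interpolation s_ (fun t => `[< F [set n | h_ n t] >]).
have [s sP] : exists s, cylinder v s `<=` [set w | `|f w| < `|f v| + 1].
  apply/nbhs_cylinderP; apply: (norm_cont v [set r | r < `|f v| + 1]).
  by apply: lt_nbhsl; rewrite ltrDl.
have Foo' : F [set n | `|f v| + 1 <= n%:R].
  by apply: Foo; exact: nbhs_infty_ger.
have [n [/= nv ns]] := filter_ex (filterI Foo' (ultra_seq_limit h_ FU s)).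
(* On vertices common to [s] and [s_ n], [v] has the limit values and [v_ n] attains them, so [w]
   lies in both cylinders. *)
have [w wP] := interpolation (fun=> s ++ s_ n)
  (fun t => if t \in s_ n then coordinate (v_ n) t else coordinate v t).
have : `|f w| < `|f v| + 1.
  apply: sP => t ts; rewrite (wP 0%N) ?mem_cat ?ts //.
  by case: ifP => // tsn; rewrite (vP n) // -ns.
rewrite ltNge (le_trans nv) // ltW //.
by apply: s_P => t tsn; rewrite (wP 0%N) ?tsn // mem_cat tsn orbT.
Qed.

(** * Strong self-duality *)

Section self_duality.
Variable R : realType.

Definition circleN1 : circle R := to_circle (normrN1 R[i]).

Lemma circleN1_neq0 : circleN1 <> 0.
Proof.
move=> /(congr1 val) /= /eqP; rewrite eq_sym -subr_eq0 opprK.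
by rewrite -(natrD _ 1 1) pnatr_eq0.
Qed.

(** Here [0] is the complex number 1, so the values are 1 and -1. *)
Definition sign (b : bool) : circle R := if b then circleN1 else 0.

Lemma signD a b : sign (a + b) = sign a + sign b.
Proof.
case: a; case: b => //=; rewrite ?addr0 ?add0r //.
by apply: val_inj; rewrite /= mulrNN mulr1.
Qed.

Lemma sign_inj : injective sign.
Proof. by case=> -[] //= => [|/esym] /circleN1_neq0. Qed.

Lemma circle_double_eq0 (z : circle R) : z + z = 0 -> exists b, z = sign b.
Proof.
move=> /(congr1 val); rewrite circle_valD circle_val0 -expr2 => /eqP.
rewrite sqrf_eq1 => /orP[/eqP z1|/eqP z1].
  by exists false; apply: val_inj.
by exists true; apply: val_inj.
Qed.

Lemma circle_open_neq (z : circle R) : open [set w | w <> z].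
Proof.
have -> : [set w | w <> z] = val @^-1` ~` [set val z : (R[i])^o].
  by apply/seteqP; split=> w wz; [move=> /val_inj | move=> /(congr1 val)].
apply: open_comp => [w _|]; first exact: circle_val_continuous.
exact/closed_openC/accessible_closed_set1/hausdorff_accessible/norm_hausdorff.
Qed.

Lemma pairing_char_subproof x :
  characters (fun y : bgroup => sign (pairing x y)).
Proof.
split=> [y|y y']; last by rewrite pairingDr signD.
have [s sP] := ev_support x.
move=> U /nbhs_singleton Uy; apply/nbhs_cylinderP; exists s => y' yy' /=.
suff -> : pairing x y' = pairing x y by [].
rewrite !(pairing_sym x) /pairing !sP.
exact: eq_big_seq.
Qed.

Definition pairing_char x : dual R bgroup := to_dual (pairing_char_subproof x).

Lemma pairing_charE x y : pairing_char x y = sign (pairing x y).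
Proof. by []. Qed.

Lemma pairing_char_inj : injective pairing_char.
Proof.
move=> x y /(congr1 (@dual_fun R bgroup)) xy; apply: contrapT.
move=> /coordinate_separates[t]; apply; rewrite -!pairing_basis.
by apply: sign_inj; rewrite -!pairing_charE xy.
Qed.

(** A form vanishing on a finite intersection of kernels is a combination of the forms defining
    them. Unless [t] is redundant, [v] shows that [c] equals the coordinate at [t] on the remaining
    kernels, and adding that coordinate removes [t]. *)
Lemma additive_cylinder_pairing (s : seq vertex) (c : bgroup -> bool) :
  {morph c : x y / x + y} -> (forall y, cylinder 0 s y -> c y = 0) ->
  exists x, forall y, c y = pairing x y.
Proof.
elim: s c => [|t s IH] c cD c0.
  by exists 0 => y; rewrite c0 // pairing_sym.
have [c0'|/existsNP[v /not_implyP[v0 cv]]] :=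
  pselect (forall y, cylinder 0 s y -> c y = 0); first exact: IH.
have {}cv : c v = 1 by case: (c v) cv.
have step y : cylinder 0 s y -> coordinate y t = 0 -> c y = 0.
  move=> y0 yt; apply: c0 => t'.
  by rewrite inE => /orP[/eqP->//|]; exact: y0.
have vt : coordinate v t = 1.
  case: (coordinate v t) (step v v0) => // /(_ erefl) /eqP.
  by rewrite cv.
have [|y y0|x xP] := IH (fun y => c y + coordinate y t).
- by move=> y y'; rewrite cD coordinateD addrACA.
- case yt: (coordinate y t); last by rewrite (step y).
  have : c (y + v) = 0.
    apply: step => [t' t's|]; rewrite coordinateD ?yt ?vt //.
    by rewrite y0 // v0.
  by rewrite cD cv.
- exists (x + basis_vector t) => y.
  rewrite pairingDl -xP (pairing_sym (basis_vector t)) pairing_basis -addrA.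
  have -> : coordinate y t + coordinate y t = 0 := addbb _.
  by rewrite addr0.
Qed.

Lemma pairing_char_surj (chi : dual R bgroup) :
  exists x, pairing_char x = chi.
Proof.
have chi0 : chi 0 = 0.
  by apply: (addrI (chi 0)); rewrite -dualD !addr0.
have /choice[c cP] y : exists b, chi y = sign b.
  by apply: circle_double_eq0; rewrite -dualD bgroup_boolean.
(* As [chi] only takes the values 1 and -1, avoiding -1 near 0 means being trivial there. *)
have [s sP] : exists s, cylinder 0 s `<=` [set y | chi y <> circleN1].
  apply/nbhs_cylinderP.
  apply: (@dual_continuous _ _ chi 0 [set z | z <> circleN1]).
  apply: open_nbhs_nbhs; split.
    exact: circle_open_neq.
  by rewrite /= chi0 => /esym/circleN1_neq0.
have [|y y0|x xP] := @additive_cylinder_pairing s c.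
- by move=> y y'; apply: sign_inj; rewrite signD -!cP dualD.
- by move: (sP y y0); rewrite /= cP; case: (c y) => //= /(_ erefl).
- exists x; apply: val_inj; apply/funext => y.
  by rewrite [RHS]cP xP.
Qed.

(** Compact sets being finite, only finitely many evaluations are to be controlled, and each is
    continuous in [x] by symmetry of the pairing. *)
Lemma pairing_char_continuous : continuous pairing_char.
Proof.
apply: (@continuous_comp_initial _ _ _
  (set_val : set_type (@characters R bgroup) -> _)) => x.
have FF : Filter ((set_val \o pairing_char) x' @[x' --> x]).
  exact: (@fmap_filter _ _ _ _ (nbhs_filter x)).
apply: (compact_open_cvgP _ FF).2 => K O /bgroup_compact_finite finK oO xKO.
have [s sE] := (finite_seqP _).1 finK.
have nearO y : O (pairing_char x y) -> nbhs x [set x' | O (pairing_char x' y)].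
  rewrite pairing_charE pairing_sym -pairing_charE => Oy.
  rewrite [X in nbhs x X](_ : _ = pairing_char y @^-1` O).
    apply: (@dual_continuous _ _ (pairing_char y) x O).
    by apply: open_nbhs_nbhs; split.
  by apply/funext => x'; rewrite /= !pairing_charE pairing_sym.
suff : nbhs x [set x' | forall y, y \in s -> O (pairing_char x' y)].
  by apply: filterS => x' sO _ [y + <-]; rewrite sE => /sO.
have {xKO} : forall y, y \in s -> O (pairing_char x y).
  by move=> y ys; apply: xKO; exists y => //; rewrite sE.
elim: s {sE} => [|y s IH] xO; first by apply: filterS filterT => x' _ y.
have IH' := IH (fun z zs => xO z (mem_behead (s := y :: s) zs)).
apply: filterS2 (nearO y (xO y (mem_head _ _))) IH' => x' Oy sO z.
by rewrite inE => /orP[/eqP->//|]; exact: sO.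
Qed.

Lemma dual_eval_open (y : bgroup) (O : set (circle R)) :
  open O -> open [set chi : dual R bgroup | O (chi y)].
Proof.
move=> oO.
have oC := compact_open_open (@compact_set1 bgroup y) oO.
exists [set g | g @` [set y] `<=` O] => //.
by apply/seteqP; split=> chi /= Oy => [|_ [_ -> <-]//]; apply: Oy; exists y.
Qed.

Lemma bgroup_strongly_self_dual : strongly_self_dual R bgroup.
Proof.
exists pairing_char; last by move=> x y; rewrite !pairing_charE pairing_sym.
have [g gP] := choice pairing_char_surj.
split; [|exact: pairing_char_continuous|exists g; split=> //].
- move=> x y; apply: val_inj; apply/funext => z.
  by rewrite -[LHS]/(sign _) pairingDl signD.
- by move=> x; exact: pairing_char_inj.
move=> chi U /nbhs_cylinderP[s sU].
suff : nbhs chi [set chi' | cylinder (g chi) s (g chi')].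
  by apply: filterS => chi'; exact: sU.
elim: s {sU} => [|t s IH]; first by apply: filterS filterT => chi' _ t.
pose y := basis_vector t.
have gy (chi' : dual R bgroup) : chi' y = sign (coordinate (g chi') t).
  by rewrite -[in LHS](gP chi') pairing_charE pairing_basis.
(* Values at [y] are signs, so excluding the wrong one is an open condition that fixes coordinate
   [t] of [g chi']. *)
have yO : open_nbhs chi
    [set chi' : dual R bgroup | chi' y <> sign (~~ coordinate (g chi) t)].
  split; first exact: dual_eval_open (circle_open_neq _).
  by rewrite /= gy => /sign_inj; case: (coordinate _ _).
apply: filterS2 (open_nbhs_nbhs yO) IH => chi' /= chiy' sP t'.
rewrite inE => /orP[/eqP->|/sP//].
move: chiy'; rewrite gy.
by case: (coordinate (g chi') t); case: (coordinate (g chi) t).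
Qed.

End self_duality.

Theorem corollary5p8 (R : realType) :
  exists G : topologicalZmodType,
    [/\ hausdorff_space G, boolean_group G, pseudocompact R G,
        strongly_self_dual R G & ~ selectively_pseudocompact G].
Proof.
exists bgroup; split.
- exact: bgroup_hausdorff.
- exact: bgroup_boolean.
- exact: bgroup_pseudocompact.
- exact: bgroup_strongly_self_dual.
- exact: bgroup_not_selectively_pseudocompact.
Qed.
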